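(* Let $L_1$ and $L_2$ be nontrivial finite transitive permutation groups. If one of $L_1$ and $L_2$ is not semiprimitive, then for every integer $c$ there exists a rank two faithful amalgam of permutation type $[L_1,L_2]$ whose Borel subgroup has order at least $c$.
   Context: For $k\ge 2$, a rank $k$ amalgam is a finite set $\mathcal A$ with $k$ subsets $P_1,\dots,P_k$, each of which is a group, such that $\bigcup_i P_i=\mathcal A$, $\bigcap_i P_i\neq\emptyset$, and for all $i,j$ the group operations of $P_i$ and $P_j$ agree on $P_i\cap P_j$. Its Borel subgroup is $\mathcal B(\mathcal A)=\bigcap_i P_i$. $\mathcal A$ is faithful if no nontrivial subgroup of $\mathcal B(\mathcal A)$ is normalised by every $P_i$. Its permutation type is the multiset $[L_1,\dots,L_k]$ where $L_i$ is the permutation group induced by $P_i$ acting on the right cosets of $\mathcal B(\mathcal A)$ in $P_i$ (up to permutation isomorphism). A permutation group is semiregular if only the identity fixes a point, and semiprimitive if each of its normal subgroups is either transitive or semiregular. *)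

(* Defs.v *)
From mathcomp Require Import all_boot all_fingroup.

Set Implicit Arguments.
Unset Strict Implicit.
Unset Printing Implicit Defensive.

Import GroupScope.

Definition perm_transitive (T : finType) (G : {group {perm T}}) : bool :=
  [transitive G, on [set: T] | 'P].

Definition perm_semiregular (T : finType) (G : {group {perm T}}) : Prop :=
  forall g, g \in G -> forall x : T, g x = x -> g = 1.

Definition perm_semiprimitive (T : finType) (G : {group {perm T}}) : Prop :=
  forall N : {group {perm T}}, N <| G ->
    perm_transitive N \/ perm_semiregular N.

Record permGroup := PermGroup {
  pg_points : finType;
  pg_group :> {group {perm pg_points}}
}.

Definition perm_isomorphic (G H : permGroup) : Prop :=
  exists (f : pg_points G -> pg_points H)
         (psi : {morphism G >-> {perm pg_points H}}),
    [/\ bijective f, isom G H psi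
      & forall g, g \in G -> forall x, f (g x) = psi g (f x)].

Section CosetAction.
Variables (gT : finGroupType) (H : {set gT}).

Definition right_coset := {X : {set gT} | X \in rcosets H [set: gT]}.

Definition right_coset_action := ('Rs^? : action _ right_coset).

(* A partial action carries a domain; here it is the whole group. *)
Lemma right_coset_action_dom :
  subact_dom [in rcosets H [set: gT]] 'Rs = [set: gT].
Proof.
apply/eqP; rewrite eqEsubset subsetT /=.
apply/subsetP=> g _; apply/astabsP=> X; rewrite !inE /= rcosetE.
have shift (Y : {set gT}) h : Y \in rcosets H setT -> Y :* h \in rcosets H setT.
  case/rcosetsP=> y _ ->; rewrite -rcosetM.
  by apply/rcosetsP; exists (y * h); rewrite ?inE.
apply/idP/idP=> [Xg|]; last exact: shift.
by rewrite -(rcosetK g X); apply: shift.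
Qed.

Definition coset_permGroup : permGroup :=
  PermGroup (actperm right_coset_action @* [set: gT])%G.

End CosetAction.

(* The group structure on the subset P_i is given by a finite group together  *)
(* with an injection into the ambient set, whose image is P_i.                *)
Record amalgam (k : nat) := Amalgam {
  amg_carrier :> finType;
  amg_grp : 'I_k -> finGroupType;
  amg_inj : forall i, amg_grp i -> amg_carrier;
  amg_part := fun i => [set amg_inj x | x : amg_grp i];
  amg_rank : (1 < k)%N;
  amg_inj_injective : forall i, injective (@amg_inj i);
  amg_cover : \bigcup_i amg_part i = [set: amg_carrier];
  amg_meet : \bigcap_i amg_part i != set0;
  amg_agree : forall i j (x y : amg_grp i) (x' y' : amg_grp j),
    amg_inj x = amg_inj x' -> amg_inj y = amg_inj y' ->
    amg_inj (x * y) = amg_inj (x' * y')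
}.

Section AmalgamTheory.
Variables (k : nat) (A : amalgam k).

Definition borel : {set A} := \bigcap_i amg_part A i.

Definition amg_in (i : 'I_k) (K : {set A}) : {set amg_grp A i} :=
  @amg_inj k A i @^-1: K.

(* For K \subset borel, being a subgroup of the Borel subgroup may be tested  *)
(* in any of the groups P_i, since their operations agree there.              *)
Definition amg_faithful : Prop :=
  forall K : {set A}, K \subset borel ->
    (forall i, group_set (amg_in i K)) ->
    (forall i, [set: amg_grp A i] \subset 'N(amg_in i K)) ->
    forall i, amg_in i K = 1.

Definition local_permGroup (i : 'I_k) : permGroup :=
  coset_permGroup (amg_in i borel).

(* The family L is read as a multiset: its order is irrelevant. *)
Definition has_permutation_type (L : 'I_k -> permGroup) : Prop :=
  exists s : 'S_k, forall i, perm_isomorphic (local_permGroup i) (L (s i)).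

End AmalgamTheory.

Definition permGroup_pair (L1 L2 : permGroup) : 'I_2 -> permGroup :=
  fun i => if i == ord0 then L1 else L2.

(* Main.v *)
Require Import Defs.
From mathcomp Require Import all_boot all_order all_fingroup all_algebra.

(* Let N <| L1 be intransitive and not semiregular. The N-orbits on T1 are    *)
(* permuted transitively by L1; fix an orbit D, a point of D and a point d of *)
(* T2. Let X consist of k+1 layers, each a copy of (orbits of N) x T2, and    *)
(* one extra point None. Both groups P1 and P2 are groups of permutations of  *)
(* T1 * X which act on the fibre T1 over each x in X by elements f(x) of L1,  *)
(* all in one coset of N depending on the permutation, and carry a base point *)
(* of the fibre over x to the base point of the image fibre. On X, P2 acts as *)
(* (stabiliser of D in L1) x L2 does in the obvious way, and P1 as            *)
(* L1 x (stabiliser of d in L2) does, except that this action is conjugated   *)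
(* by the cycle (None, (D,d,0), ..., (D,d,k)); so P1 fixes (D,d,0), and in    *)
(* that fibre alone the base point may be moved by P1. The two actions agree  *)
(* on the intersection of the two acting groups, since that intersection      *)
(* fixes every point of the cycle.                                            *)
(* Then P1 induces L1 on the fibre over (D,d,0), P2 induces L2 on             *)
(* (D, T2, 0), and in each case the point stabiliser is the intersection of   *)
(* P1 and P2. It contains a nontrivial element of N supported on any single   *)
(* fibre, so it is large. A common normal subgroup K is trivial on the fibre  *)
(* over (D,d,0), as its image there is normal in L1 and fixes a point; by     *)
(* conjugation it is trivial on all fibres, because <P1, P2> is transitive on *)
(* X: moving off the cycle inside a layer and coming back along the L1-orbit  *)
(* of (D,d,j) passes to the next point of the cycle.                          *)

Import GroupScope.

Set Implicit Arguments.
Unset Strict Implicit.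
Unset Printing Implicit Defensive.

(** Failure of semiprimitivity enters twice. As [N] is normal and not semiregular and [L1] is
    transitive, every point stabiliser in [N] is nontrivial; an element of it acting on one fibre
    only lies in both groups, so many fibres give a large Borel subgroup ([card_borel_gt]). As [N]
    is intransitive and [T2] has two points, there is room to leave the cycle inside a layer, so the
    two groups together connect all fibres ([lamp_connected]) and a common normal subgroup trivial
    on one fibre is trivial ([core_free]). The type comes from describing [P1 :&: P2] in two ways:
    in [P1] it is the stabiliser of the base point over [E0], in [P2] the stabiliser of the fibre
    over [E0] ([left_stab], [right_stab], [borel_fix]). If [L2] is the group that is not
    semiprimitive, the roles are exchanged. *)

(** * Coset actions as transitive permutation groups *)

(** Orbit-stabiliser: the coset [H :* g] corresponds to the point [phi g w]. Conjugation by this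
    bijection gives [psi] directly, so [phi] may have a kernel. *)
Lemma coset_perm_isomorphic (gT : finGroupType) (H : {set gT}) (T : finType)
    (L : {group {perm T}}) (phi : gT -> {perm T}) (w : T) :
    (forall g h, phi (g * h) = phi g * phi h) ->
    (forall g, phi g \in L) ->
    (forall l, l \in L -> exists g, phi g = l) ->
    perm_transitive L ->
    H = [set g | phi g w == w] ->
  perm_isomorphic (coset_permGroup H) (PermGroup L).
Proof.
move=> phiM phiL phi_surj trL defH.
have phi1 : phi 1 = 1 by apply: (mulgI (phi 1)); rewrite -phiM !mulg1.
have phiV g : phi g^-1 = (phi g)^-1.
  by apply: (mulgI (phi g)); rewrite -phiM !mulgV phi1.
have Hcoset g h : (h \in H :* g) = (phi h w == phi g w).
  rewrite mem_rcoset defH inE phiM permM phiV.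
  by rewrite (canF_eq (permKV _)).
have reprP (X : right_coset H) : val X = H :* repr (val X).
  have /rcosetsP[g _ defX] := valP X.
  have : repr (val X) \in val X.
    by apply: (mem_repr g); rewrite defX Hcoset.
  rewrite {2}defX Hcoset => /eqP e; rewrite {1}defX.
  by apply/setP=> h; rewrite !Hcoset e.
pose f (X : right_coset H) := phi (repr (val X)) w.
have fE (X : right_coset H) g : g \in val X -> f X = phi g w.
  by rewrite {1}(reprP X) Hcoset => /eqP ->.
have f_inj : injective f.
  move=> X Y fXY; apply: val_inj; rewrite (reprP X) (reprP Y).
  by apply/setP=> h; rewrite !Hcoset -/(f X) -/(f Y) fXY.
have f_surj t : exists X, f X = t.
  have : t \in orbit 'P L w by rewrite (atransP trL) ?inE.
  case/orbitP=> l /phi_surj[g <-] <-.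
  have Xg : H :* g \in rcosets H [set: gT] by apply/rcosetsP; exists g.
  by exists (Sub (H :* g) Xg : right_coset H); apply: fE; rewrite /= Hcoset.
have f_act (X : right_coset H) a : f (actperm (right_coset_action H) a X) = phi a (f X).
  rewrite actpermE -permM -phiM; apply: fE.
  rewrite val_subact right_coset_action_dom inE /= rcosetE.
  by rewrite mem_rcoset mulgK {2}(reprP X) Hcoset.
have dom a : a \in subact_dom [in rcosets H [set: gT]] 'Rs.
  by rewrite right_coset_action_dom inE.
have memG a : actperm (right_coset_action H) a \in coset_permGroup H.
  by apply: (mem_morphim (actperm (right_coset_action H)) (dom a)); rewrite inE.
have [g gP] : exists g, forall t, f (g t) = t.
  exact: (fin_all_exists f_surj).
have fK : cancel f g by move=> X; apply: f_inj.
have psi_inj (s : {perm right_coset H}) : injective (fun t => f (s (g t))).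
  by move=> t u /f_inj/perm_inj/(can_inj gP).
pose psi s := perm (psi_inj s).
have psiM : {in coset_permGroup H &, {morph psi : x y / x * y}}.
  by move=> x y _ _; apply/permP=> t; rewrite !(permE, permM) /= fK.
exists f, (Morphism psiM); split.
- by exists g.
- apply/isomP; split.
    apply/injmP=> x y _ _ /permP e; apply/permP=> X; apply: f_inj.
    by have := e (f X); rewrite !permE fK.
  have psi_act a : psi (actperm (right_coset_action H) a) = phi a.
    by apply/permP=> t; rewrite permE f_act gP.
  apply/setP=> l; apply/morphimP/idP => [[x _ /morphimP[a _ _ ->] ->]|].
    by rewrite /= psi_act.
  case/phi_surj=> a <-.
  by exists (actperm (right_coset_action H) a); rewrite /= ?psi_act ?memG.
- by move=> x _ X; rewrite /= permE fK.
Qed.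

(** * Amalgams formed by subgroups of one finite group *)

Section SubgroupAmalgam.
Variables (k : nat) (gT : finGroupType) (P : 'I_k -> {group gT}).
Hypothesis k_gt1 : (1 < k)%N.

Let carrier := {z : gT | z \in \bigcup_i P i}.

Fact subgroup_amalgam_mem i (x : subg_of (P i)) : sgval x \in \bigcup_j P j.
Proof. by apply/bigcupP; exists i; rewrite ?subgP. Qed.

Let inj i (x : subg_of (P i)) : carrier :=
  Sub (sgval x) (subgroup_amalgam_mem x).

Let part i := [set inj x | x : subg_of (P i)].

Fact subgroup_amalgam_partE i z : (z \in part i) = (val z \in P i).
Proof.
apply/imsetP/idP=> [[x _ ->]|Pz]; first exact: subgP.
by exists (subg (P i) (val z)) => //; apply: val_inj; rewrite /= subgK.
Qed.

Fact subgroup_amalgam_inj i : injective (@inj i).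
Proof. by move=> x y /(congr1 val) /= /val_inj. Qed.

Fact subgroup_amalgam_cover : \bigcup_i part i = [set: carrier].
Proof.
apply/setP=> z; rewrite inE; have /bigcupP[i _ Pz] := valP z.
by apply/bigcupP; exists i; rewrite ?subgroup_amalgam_partE.
Qed.

Fact subgroup_amalgam_meet : \bigcap_i part i != set0.
Proof.
apply/set0Pn; exists (inj (1 : subg_of (P (Ordinal (ltnW k_gt1))))).
by apply/bigcapP=> i _; rewrite subgroup_amalgam_partE /= group1.
Qed.

Fact subgroup_amalgam_agree i j (x y : subg_of (P i)) (x' y' : subg_of (P j)) :
  inj x = inj x' -> inj y = inj y' -> inj (x * y) = inj (x' * y').
Proof.
move=> /(congr1 val) /= ex /(congr1 val) /= ey.
by apply: val_inj; rewrite /= ex ey.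
Qed.

Definition subgroup_amalgam : amalgam k :=
  Amalgam k_gt1 subgroup_amalgam_inj subgroup_amalgam_cover
    subgroup_amalgam_meet subgroup_amalgam_agree.

Lemma subgroup_amalgam_borelE (z : subgroup_amalgam) :
  (z \in borel subgroup_amalgam) = (val z \in \bigcap_i P i).
Proof.
by apply/bigcapP/bigcapP=> Bz i _; have := Bz i isT;
  rewrite subgroup_amalgam_partE.
Qed.

Lemma card_subgroup_amalgam_borel :
  #|borel subgroup_amalgam| = #|\bigcap_i P i|.
Proof.
rewrite -(card_imset _ (val_inj : injective (val : subgroup_amalgam -> gT))).
apply: eq_card => z; apply/imsetP/idP=> [[x Bx ->]|Bz].
  by rewrite -subgroup_amalgam_borelE.
have Uz : z \in \bigcup_i P i.
  pose i0 : 'I_k := Ordinal (ltnW k_gt1).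
  by apply/bigcupP; exists i0 => //; apply: (bigcapP Bz).
by exists (Sub z Uz) => //; rewrite subgroup_amalgam_borelE.
Qed.

Lemma subgroup_amalgam_faithful :
    (forall K : {group gT}, K \subset \bigcap_i P i ->
      (forall i, P i \subset 'N(K)) -> K :=: 1) ->
  amg_faithful subgroup_amalgam.
Proof.
move=> core_free K sKB gK nK i.
have memK z : z \in K -> forall j, val z \in P j.
  by move=> /(subsetP sKB); rewrite subgroup_amalgam_borelE => /bigcapP Bz j; exact: Bz.
have K1 : exists2 z, z \in K & val z = 1.
  by exists (inj (1 : subg_of (P i))) => //; have /group_setP[] := gK i; rewrite inE.
pose K' := [set val z | z in K].
(* [K] lies in every [P j], so each [P j] sees the same subset of [gT]; normalisation by [P j] can
   then be checked inside [P j]. *)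
have K'i j : K' = sgval @: amg_in j K.
  apply/setP=> z; apply/imsetP/imsetP=> [[x Kx ->]|[x Kx ->]]; last first.
    by exists (inj x) => //; rewrite inE in Kx.
  exists (subg (P j) (val x)); rewrite ?subgK ?memK // inE.
  suff -> : @amg_inj k subgroup_amalgam j (subg (P j) (val x)) = x by [].
  by apply: val_inj; rewrite /= subgK ?memK.
have gK' : group_set K'.
  have := group_setP (gK i) => -[G1 GM]; apply/group_setP; rewrite (K'i i).
  split; first by apply/imsetP; exists 1.
  move=> _ _ /imsetP[x Kx ->] /imsetP[y Ky ->].
  by apply/imsetP; exists (x * y); rewrite ?GM.
have K'1 : Group gK' :=: 1.
  apply: core_free => [|j].
    by apply/subsetP=> _ /imsetP[z Kz ->]; apply/bigcapP=> j _; apply: memK.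
  apply/subsetP=> p Pp; rewrite inE /= (K'i j).
  apply/subsetP=> _ /imsetP[_ /imsetP[x Kx ->] ->].
  have := subsetP (nK j) (subg (P j) p) (in_setT _); rewrite inE => /subsetP nKp.
  apply/imsetP; exists (x ^ subg (P j) p); first by apply: nKp; rewrite memJ_conjg.
  by rewrite morphJ ?inE //= subgK.
apply/setP=> x; rewrite !inE; apply/idP/eqP=> [Kx|->].
  have: sgval x \in Group gK' by apply/imsetP; exists (inj x).
  by rewrite K'1 => /set1P e; apply: val_inj.
by have [G1 _] := group_setP (gK i); rewrite inE in G1.
Qed.

(** [R g l] stands for [g] inducing [l]. It is a relation because elements of [gT] outside [P i]
    need not induce any permutation of [T]. *)
Lemma subgroup_amalgam_local i (T : finType) (L : {group {perm T}})
    (R : gT -> {perm T} -> Prop) (w : T) :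
    perm_transitive L ->
    (forall g, g \in P i -> exists2 l, l \in L & R g l) ->
    (forall l, l \in L -> exists2 g, g \in P i & R g l) ->
    (forall g h l m, R g l -> R h m -> R (g * h) (l * m)) ->
    (forall g l m, R g l -> R g m -> l = m) ->
    (forall g l, g \in P i -> R g l -> (g \in \bigcap_j P j) = (l w == w)) ->
  perm_isomorphic (local_permGroup subgroup_amalgam i) (PermGroup L).
Proof.
move=> trL RL R_surj RM R_inj RB.
have [|phi phiL phiR] := @fin_all_exists2 (subg_of (P i)) _
    (fun _ l => l \in L) (fun g l => R (sgval g) l).
  by move=> g; apply: RL; apply: subgP.
apply: (@coset_perm_isomorphic _ _ _ _ phi w) => //.
- by move=> g h; apply: (R_inj (sgval g * sgval h)); [apply: (phiR (g * h)) | apply: RM].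
- move=> l /R_surj[g Pg Rgl]; exists (subg (P i) g).
  by apply: R_inj (phiR _) _; rewrite /= subgK.
- apply/setP=> g; rewrite !inE subgroup_amalgam_borelE /=.
  by rewrite (RB _ _ (subgP g) (phiR g)).
Qed.

End SubgroupAmalgam.

Lemma perm_transitiveP (T : finType) (G : {group {perm T}}) (s t : T) :
  perm_transitive G -> exists2 g, g \in G & g s = t.
Proof.
move=> trG; have : t \in orbit 'P G s by rewrite (atransP trG) ?inE.
by case/orbitP=> g Gg <-; exists g.
Qed.

(** * Permutations of fibres lying in one coset of [N] *)

Section Twisted.
Variables (T X : finType) (N : {group {perm T}}) (lab : X -> T) (S : {set X}).
Implicit Types (q : X -> X) (r : {perm T}) (z : {perm T * X}).

(* [lab] gives the base points; [S] is where they have to be preserved. *)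
Definition twisted (q : X -> X) (r : {perm T}) (z : {perm T * X}) : bool :=
  [forall x, exists f in N :* r,
     [forall y, z (y, x) == (f y, q x)] &&
     ((x \in S) ==> (f (lab x) == lab (q x)))].

Lemma twistedP q r z :
  reflect (forall x, exists f : {perm T},
             [/\ f \in N :* r, forall y, z (y, x) = (f y, q x)
               & x \in S -> f (lab x) = lab (q x)])
          (twisted q r z).
Proof.
apply: (iffP forallP) => tz x.
  have /exists_inP[f Nf /andP[/forallP zE /implyP fS]] := tz x.
  by exists f; split=> // [y|/fS/eqP]; first exact/eqP.
have [f [Nf zE fS]] := tz x; apply/exists_inP; exists f => //.
apply/andP; split; first by apply/forallP=> y; rewrite zE.
by apply/implyP=> /fS ->.
Qed.

Lemma eq_twisted q q' r z : q =1 q' -> twisted q r z -> twisted q' r z.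
Proof.
move=> eqq /twistedP tz; apply/twistedP=> x; have [f [Nf zE fS]] := tz x.
by exists f; split=> // [y|/fS]; rewrite -eqq.
Qed.

Lemma twisted1 q : q =1 id -> twisted q 1 1.
Proof.
move=> q1; apply/twistedP=> x; exists 1.
by split=> [|y|_]; rewrite ?rcoset_refl ?perm1 ?q1.
Qed.

Lemma twistedM q q' r r' z z' :
    r \in 'N(N) -> {in S, forall x, q x \in S} ->
    twisted q r z -> twisted q' r' z' ->
  twisted (fun x => q' (q x)) (r * r') (z * z').
Proof.
move=> nNr qS /twistedP tz /twistedP tz'; apply/twistedP=> x.
have [f [Nf zE fS]] := tz x; have [f' [Nf' zE' fS']] := tz' (q x).
exists (f * f'); split=> [|y|Sx]; last 2 first.
- by rewrite !permM zE zE'.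
- by rewrite permM fS // fS' // qS.
by rewrite -rcoset_mul // mem_mulg.
Qed.

Lemma twisted_ex (q : X -> X) r (f : X -> {perm T}) :
    injective q -> (forall x, f x \in N :* r) ->
    {in S, forall x, f x (lab x) = lab (q x)} ->
  exists2 z, twisted q r z & forall x y, z (y, x) = (f x y, q x).
Proof.
move=> q_inj Nf fS.
have z_inj : injective (fun yx => (f yx.2 yx.1, q yx.2)).
  move=> [y x] [y' x'] [/= fyy' /q_inj xx']; move: fyy'; rewrite xx'.
  by move/perm_inj=> ->.
exists (perm z_inj) => [|x y]; last by rewrite permE.
by apply/twistedP=> x; exists (f x); split=> // [y|/fS]; rewrite ?permE.
Qed.

End Twisted.

(** * The action on layers and its base points *)

Section Construction.
(* [pi] is the quotient map of T1 onto the orbits of N and [b] a section of   *)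
(* it, providing the base points.                                             *)
Variables (T1 T2 Sigma : finType) (k : nat).
Variables (L1 N : {group {perm T1}}) (L2 : {group {perm T2}}).
Variables (pi : T1 -> Sigma) (b : Sigma -> T1) (D : Sigma) (d : T2).
Hypotheses (nNL1 : N <| L1) (bK : cancel b pi).
Hypothesis piP : forall y y', reflect (exists2 n, n \in N & n y = y') (pi y == pi y').
Arguments piP {y y'}.

Local Notation X := (option (Sigma * T2 * 'I_k.+1)).
Implicit Types (x : X) (j : 'I_k.+1) (r : {perm T1}) (l : {perm T2}).

Definition layer_point j : X := Some (D, d, j).
Local Notation E := layer_point.
Local Notation E0 := (E ord0).

Definition base_point x : T1 := if x is Some (s, _, _) then b s else b D.
Local Notation lab := base_point.
Local Notation w := (b D).

(** [pi (r (b s))] is the image under [r] of the orbit [s]; for [r] in [L1] it does not depend on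
    the representative [b s]. *)
Definition lamp_act r l x : X :=
  if x is Some (s, t, j) then Some (pi (r (b s)), l t, j) else None.
Local Notation act := lamp_act.

Lemma pi_mem_N n y : n \in N -> pi (n y) = pi y.
Proof. by move=> Nn; apply/esym/eqP/piP; exists n. Qed.

Lemma pi_perm r y y' : r \in L1 -> pi y = pi y' -> pi (r y) = pi (r y').
Proof.
move=> L1r /eqP/piP[n Nn <-]; apply/eqP/piP; exists (n ^ r).
  by rewrite memJ_norm // (subsetP (normal_norm nNL1)).
by rewrite permJ.
Qed.

Lemma pi_b_perm r y : r \in L1 -> pi (r (b (pi y))) = pi (r y).
Proof. by move=> L1r; apply: pi_perm; rewrite ?bK. Qed.

Lemma lamp_act1 x : act 1 1 x = x.
Proof. by case: x => [[[s t] j]|] //=; rewrite !perm1 bK. Qed.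

Lemma lamp_actM r r' l l' x : r' \in L1 ->
  act (r * r') (l * l') x = act r' l' (act r l x).
Proof.
by move=> L1r'; case: x => [[[s t] j]|] //=; rewrite !permM pi_b_perm.
Qed.

Lemma lamp_act_inj r l : r \in L1 -> injective (act r l).
Proof.
move=> L1r; apply: (can_inj (g := act r^-1 l^-1)) => x.
by rewrite -lamp_actM ?groupV // !mulgV lamp_act1.
Qed.

(** This is the condition under which [lift_ex] corrects [r] by an element of [N] to match base
    points. It may fail at [None], which stays put while [r] can move [D]. *)
Lemma pi_lab r l x : r \in L1 -> x != None ->
  pi (r (lab x)) = pi (lab (act r l x)).
Proof. by move=> L1r; case: x => [[[s t] j]|] //= _; rewrite bK. Qed.

Definition block_stab : {set {perm T1}} := [set r in L1 | pi (r w) == D].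
Local Notation H := block_stab.

Fact block_stab_group_set : group_set H.
Proof.
apply/group_setP; split=> [|r r']; first by rewrite inE group1 perm1 bK /=.
rewrite !inE => /andP[L1r /eqP rD] /andP[L1r' /eqP r'D].
rewrite groupM //= permM; apply/eqP; rewrite -{2}r'D.
by apply: pi_perm; rewrite ?bK.
Qed.
Canonical block_stab_group := Group block_stab_group_set.

Definition point_stab2 : {group {perm T2}} := 'C_L2[d | 'P]%G.
Local Notation M := point_stab2.

Lemma point_stab2E l : (l \in M) = (l \in L2) && (l d == d).
Proof. by rewrite inE (sameP astab1P eqP). Qed.

Lemma pi_lab_block r l x : r \in H -> pi (r (lab x)) = pi (lab (act r l x)).
Proof.
rewrite inE => /andP[L1r /eqP rD].
by case: x => [[[s t] j]|] /=; rewrite bK.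
Qed.

(** * Conjugation by the cycle *)

Definition lamp_cycle : seq X := None :: [seq E j | j <- enum 'I_k.+1].
Local Notation c := lamp_cycle.
Local Notation nx := (next c).
Local Notation pv := (prev c).

Lemma uniq_lamp_cycle : uniq c.
Proof.
rewrite /= map_inj_uniq ?enum_uniq ?andbT => [|j j' [] //].
by apply/mapP=> -[j].
Qed.
Local Notation Uc := uniq_lamp_cycle.

Lemma lamp_cycleP x : reflect (x = None \/ exists j, x = E j) (x \in c).
Proof.
rewrite inE; apply: (iffP orP) => [[/eqP|/mapP[j _ ->]]|[->|[j ->]]].
- by left.
- by right; exists j.
- by left.
- by right; rewrite map_f ?mem_enum.
Qed.

Lemma lamp_cycle_nextNone : nx None = E0.
Proof. by rewrite /= enum_ordSl. Qed.

Lemma lamp_cycle_next_id x : x \notin c -> nx x = x.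
Proof. by rewrite next_nth => /negPf->. Qed.

Lemma lamp_cycle_prev_id x : x \notin c -> pv x = x.
Proof. by rewrite prev_nth => /negPf->. Qed.

Lemma lab_cycle x : x \in c -> lab x = w.
Proof. by case/lamp_cycleP=> [->|[j ->]]. Qed.

Lemma lab_next x : lab (nx x) = lab x.
Proof.
have [xc|/lamp_cycle_next_id->//] := boolP (x \in c).
by rewrite !lab_cycle ?mem_next.
Qed.

Lemma lab_prev x : lab (pv x) = lab x.
Proof. by rewrite -lab_next next_prev ?Uc. Qed.

Definition lamp_act_conj r l x : X := nx (act r l (pv x)).
Local Notation act1 := lamp_act_conj.

Lemma lamp_act_conj1 x : act1 1 1 x = x.
Proof. by rewrite /act1 lamp_act1 next_prev ?Uc. Qed.

Lemma lamp_act_conjM r r' l l' x : r' \in L1 ->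
  act1 (r * r') (l * l') x = act1 r' l' (act1 r l x).
Proof. by move=> L1r'; rewrite /act1 prev_next ?Uc // lamp_actM. Qed.

Lemma lamp_act_conj_inj r l : r \in L1 -> injective (act1 r l).
Proof.
move=> L1r x x' /(can_inj (prev_next Uc)) /(lamp_act_inj L1r).
exact: (can_inj (next_prev Uc)).
Qed.

Lemma lamp_act_conjE0 r l : act1 r l E0 = E0.
Proof. by rewrite /act1 -{1}lamp_cycle_nextNone prev_next ?Uc // lamp_cycle_nextNone. Qed.

Lemma lamp_act_conj_neq r l x : r \in L1 -> x != E0 -> act1 r l x != E0.
Proof.
by move=> L1r; apply: contra => /eqP; rewrite -{1}(lamp_act_conjE0 r l) => /lamp_act_conj_inj->.
Qed.

(** The cycle preserves base points and sends [None] to [E0], so the exceptional point of [pi_lab]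
    moves to [E0]. *)
Lemma pi_lab_conj r l x : r \in L1 -> x != E0 ->
  pi (r (lab x)) = pi (lab (act1 r l x)).
Proof.
move=> L1r xE0; rewrite lab_next -lab_prev; apply: pi_lab => //.
by apply: contra xE0 => /eqP e; rewrite -lamp_cycle_nextNone -e next_prev ?Uc.
Qed.

Lemma lamp_act_cycle r l x : r \in H -> l \in M -> x \in c -> act r l x = x.
Proof.
rewrite inE point_stab2E => /andP[_ /eqP rD] /andP[_ /eqP ld].
by case/lamp_cycleP=> [->|[j ->]] //=; rewrite rD ld.
Qed.

(** Such a pair fixes the cycle pointwise, hence its action commutes with the cycle. *)
Lemma lamp_act_conj_block r l x : r \in H -> l \in M -> act1 r l x = act r l x.
Proof.
move=> Hr Ml; have L1r : r \in L1 by move: Hr; rewrite inE => /andP[].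
have [xc|xc] := boolP (x \in c).
  by rewrite /act1 !lamp_act_cycle ?mem_prev // next_prev ?Uc.
rewrite /act1 (lamp_cycle_prev_id xc) lamp_cycle_next_id //.
apply: contra xc => axc.
by have /(lamp_act_inj L1r) <- := lamp_act_cycle Hr Ml axc.
Qed.

Lemma lift_ex r y y' : r \in L1 -> pi (r y) = pi y' ->
  exists2 f : {perm T1}, f \in N :* r & f y = y'.
Proof.
move=> L1r /eqP/piP[n Nn <-]; exists (r * n); last by rewrite permM.
rewrite norm_rlcoset ?mem_lcoset ?mulKg //.
exact: (subsetP (normal_norm nNL1)).
Qed.

Lemma rcoset_sub_L1 r (f : {perm T1}) : r \in L1 -> f \in N :* r -> f \in L1.
Proof.
move=> L1r /rcosetP[n Nn ->]; rewrite groupM //.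
exact: (subsetP (normal_sub nNL1)).
Qed.

(** * The two groups and their intersection *)

Definition left_set : {set {perm T1 * X}} :=
  [set z | [exists r in L1, exists l in M,
              twisted N lab [set~ E0] (act1 r l) r z]].

Definition right_set : {set {perm T1 * X}} :=
  [set z | [exists r in H, exists l in L2, twisted N lab setT (act r l) r z]].

Lemma left_setP z :
  reflect (exists r l, [/\ r \in L1, l \in M
                         & twisted N lab [set~ E0] (act1 r l) r z])
          (z \in left_set).
Proof.
rewrite inE; apply: (iffP exists_inP) => [[r L1r /exists_inP[l Ml tz]]|].
  by exists r, l.
by case=> r [l [L1r Ml tz]]; exists r => //; apply/exists_inP; exists l.
Qed.

Lemma right_setP z :
  reflect (exists r l, [/\ r \in H, l \in L2
                         & twisted N lab setT (act r l) r z])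
          (z \in right_set).
Proof.
rewrite inE; apply: (iffP exists_inP) => [[r L1r /exists_inP[l Ml tz]]|].
  by exists r, l.
by case=> r [l [L1r Ml tz]]; exists r => //; apply/exists_inP; exists l.
Qed.

Fact left_group_set : group_set left_set.
Proof.
apply/group_setP; split=> [|z z' /left_setP[r [l [L1r Ml tz]]]].
  by apply/left_setP; exists 1, 1; rewrite !group1 twisted1 //; apply: lamp_act_conj1.
move=> /left_setP[r' [l' [L1r' Ml' tz']]].
apply/left_setP; exists (r * r'), (l * l'); split; rewrite ?groupM //.
have := twistedM _ _ tz tz'; rewrite (subsetP (normal_norm nNL1)) // => tzz'.
apply: eq_twisted (tzz' isT _) => x; first by rewrite lamp_act_conjM.
by rewrite !inE; apply: lamp_act_conj_neq.
Qed.
Canonical left_group := Group left_group_set.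

Lemma block_stab_L1 r : r \in H -> r \in L1.
Proof. by rewrite inE => /andP[]. Qed.

Fact right_group_set : group_set right_set.
Proof.
apply/group_setP; split=> [|z z' /right_setP[r [l [Hr Ml tz]]]].
  by apply/right_setP; exists 1, 1; rewrite !group1 twisted1 //; apply: lamp_act1.
move=> /right_setP[r' [l' [Hr' Ml' tz']]].
apply/right_setP; exists (r * r'), (l * l'); split; rewrite ?groupM //.
have L1r := block_stab_L1 Hr; have L1r' := block_stab_L1 Hr'.
have := twistedM _ _ tz tz'; rewrite (subsetP (normal_norm nNL1)) // => tzz'.
by apply: eq_twisted (tzz' isT _) => x; rewrite ?inE // lamp_actM.
Qed.
Canonical right_group := Group right_group_set.

Local Notation P1 := left_group.
Local Notation P2 := right_group.

(** The base point over [E0] is unconstrained, so any [g] in the coset can be prescribed there;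
    taking [g] to be [r] realises all of [L1] on that fibre. *)
Lemma left_ex r l (g : {perm T1}) : r \in L1 -> l \in M -> g \in N :* r ->
  exists z, [/\ z \in P1, forall y, z (y, E0) = (g y, E0)
    & forall x, exists f : {perm T1}, forall y, z (y, x) = (f y, act1 r l x)].
Proof.
move=> L1r Ml Ng.
have [|f Nf fS] := @fin_all_exists2 X _ (fun x f => f \in N :* r)
    (fun x f => x != E0 -> f (lab x) = lab (act1 r l x)).
  move=> x; have [->|xE0] := eqVneq x E0; first by exists g; rewrite ?eqxx.
  by have [f Nf fx] := lift_ex L1r (pi_lab_conj l L1r xE0); exists f.
pose f' x := if x == E0 then g else f x.
have [||z tz zE] := twisted_ex (N := N) (lab := lab) (S := [set~ E0]) (r := r) (f := f')
    (@lamp_act_conj_inj r l L1r).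
- by move=> x; rewrite /f'; case: eqP.
- by move=> x; rewrite !inE /f' => xE0; rewrite (negPf xE0) fS.
exists z; split=> [|y|x]; last by exists (f' x).
  by apply/left_setP; exists r, l.
by rewrite zE /f' eqxx lamp_act_conjE0.
Qed.

Lemma right_ex r l : r \in H -> l \in L2 ->
  exists2 z, z \in P2
    & forall x, exists f : {perm T1}, forall y, z (y, x) = (f y, act r l x).
Proof.
move=> Hr L2l; have L1r := block_stab_L1 Hr.
have [|f Nf fS] := @fin_all_exists2 X _ (fun x f => f \in N :* r)
    (fun x f => f (lab x) = lab (act r l x)).
  by move=> x; apply: lift_ex => //; apply: pi_lab_block.
have [|z tz zE] := twisted_ex (N := N) (lab := lab) (S := setT)
    (@lamp_act_inj r l L1r) Nf; first by move=> x _.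
exists z => [|x]; last by exists (f x).
by apply/right_setP; exists r, l.
Qed.

(** An element of [N :* r] fixing [w] forces [r] to preserve [D], so both actions on [X] agree; the
    only base point that [P1] could move is fixed by assumption. *)
Lemma left_stab z : z \in P1 -> z (w, E0) = (w, E0) -> z \in P2.
Proof.
case/left_setP=> r [l [L1r Ml tz]] zE0.
have /twistedP/(_ E0)[f [Nf zE _]] := tz.
have fw : f w = w by move: zE0; rewrite zE => -[].
have Hr : r \in H.
  rewrite inE L1r -{2}(bK D) -{2}fw.
  by have /rcosetP[n Nn ->] := Nf; rewrite permM; apply/eqP/pi_perm; rewrite ?pi_mem_N.
have L2l : l \in L2 by move: Ml; rewrite point_stab2E => /andP[].
apply/right_setP; exists r, l; split=> //; apply/twistedP=> x.
have /twistedP/(_ x)[g [Ng zx gS]] := tz.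
exists g; split=> // [y|_]; first by rewrite zx lamp_act_conj_block.
have [xE0|xE0] := eqVneq x E0; last first.
  by rewrite gS ?inE // lamp_act_conj_block.
rewrite -lamp_act_conj_block // xE0 lamp_act_conjE0 /=.
by have := zx w; rewrite xE0 zE0 => -[].
Qed.

Lemma right_stab z : z \in P2 -> (z (w, E0)).2 = E0 -> z \in P1.
Proof.
case/right_setP=> r [l [Hr L2l tz]].
have /twistedP/(_ E0)[f [_ zE _]] := tz.
rewrite zE /= => -[_ ld].
have Ml : l \in M by rewrite point_stab2E L2l ld /=.
apply/left_setP; exists r, l; split=> //; first exact: block_stab_L1.
apply/twistedP=> x; have /twistedP/(_ x)[g [Ng zx gS]] := tz.
by exists g; split=> // [y|_]; rewrite ?zx ?gS ?inE // lamp_act_conj_block.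
Qed.

Lemma left_fibre z : z \in P1 ->
  exists2 g : {perm T1}, g \in L1 & forall y, z (y, E0) = (g y, E0).
Proof.
case/left_setP=> r [l [L1r Ml tz]]; have /twistedP/(_ E0)[f [Nf zE _]] := tz.
by exists f => [|y]; [apply: rcoset_sub_L1 Nf | rewrite zE lamp_act_conjE0].
Qed.

(** [P1] preserves the fibre over [E0], and [P2] carries base points to base points. *)
Lemma borel_fix z : z \in P1 -> z \in P2 -> z (w, E0) = (w, E0).
Proof.
move=> /left_fibre[g _ zg] /right_setP[r [l [Hr _ tz]]].
have /twistedP/(_ E0)[f [_ zE /(_ (in_setT _)) fS]] := tz.
have e : act r l E0 = E0 by have /(congr1 snd) := zE w; rewrite zg.
by rewrite zE e; congr (_, _); rewrite [LHS]fS e.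
Qed.

Lemma right_fibre z : z \in P2 -> exists2 l, l \in L2
  & forall t y, (z (y, Some (D, t, ord0))).2 = Some (D, l t, ord0).
Proof.
case/right_setP=> r [l [Hr L2l tz]]; exists l => // t y.
have /twistedP/(_ (Some (D, t, ord0)))[f [_ zE _]] := tz.
by rewrite zE /=; move: Hr; rewrite inE => /andP[_ /eqP->].
Qed.

(** * Size of the Borel subgroup *)

Hypothesis N_stab : forall y, exists n : {perm T1}, [/\ n \in N, n y = y & n != 1].

Lemma card_borel_gt : (k < #|P1 :&: P2|)%N.
Proof.
have lamp x : exists z, [/\ z \in P1 :&: P2,
    forall x' y, x' != x -> z (y, x') = (y, x') & exists y, z (y, x) != (y, x)].
  have [n [Nn nfix n1]] := N_stab (lab x).
  pose f x' := if x' == x then n else 1.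
  have [||z tz zE] := twisted_ex (N := N) (lab := lab) (S := setT) (r := 1)
      (f := f) (@lamp_act_inj 1 1 (group1 _)).
  - by move=> x'; rewrite rcoset1 /f; case: eqP.
  - by move=> x' _; rewrite lamp_act1 /f; case: eqP => [->|_]; rewrite ?perm1.
  have P2z : z \in P2 by apply/right_setP; exists 1, 1; rewrite !group1.
  exists z; split.
  - by rewrite inE P2z right_stab //= zE lamp_act1.
  - by move=> x' y xx'; rewrite zE lamp_act1 /f (negPf xx') perm1.
  have [y ny] : exists y, n y != y.
    apply/existsP; apply: contraR n1; rewrite negb_exists => /forallP n1.
    by apply/eqP/permP=> y; rewrite perm1; apply/eqP/negPn/n1.
  by exists y; rewrite zE /f eqxx lamp_act1 xpair_eqE eqxx andbT.
have [h hP] := fin_all_exists lamp.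
have h_inj : injective h.
  move=> x x' hxx'; apply/eqP/negPn/negP=> xx'.
  have [_ hid _] := hP x; have [_ _ [y /eqP hy]] := hP x'.
  by apply: hy; rewrite -hxx' hid // eq_sym.
have hE_card : #|[set h (E j) | j : 'I_k.+1]| = k.+1.
  by rewrite card_imset ?card_ord // => i j /h_inj[].
apply: (leq_trans (n := #|[set h (E j) | j : 'I_k.+1]|)); first by rewrite hE_card.
by apply/subset_leq_card/subsetP=> _ /imsetP[j _ ->]; have [] := hP (E j).
Qed.

(** * Connectivity, faithfulness and the resulting amalgam *)

Hypotheses (trL1 : perm_transitive L1) (trL2 : perm_transitive L2).

Hypotheses (Sigma_gt1 : exists s, s != D) (T2_gt1 : exists t, t != d).

(** Transitivity on [X] is phrased as an induction principle, ready for the property of being a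
    fibre fixed pointwise by [K]. *)
Lemma lamp_connected (Q : X -> Prop) :
    Q E0 -> (forall l x, l \in L2 -> Q x -> Q (act 1 l x)) ->
    (forall r x, r \in L1 -> Q x -> Q (act1 r 1 x)) ->
  forall x, Q x.
Proof.
move=> QE0 Qact Qact1; have [s0 s0D] := Sigma_gt1; have [t0 t0d] := T2_gt1.
have off s t j : (s, t) != (D, d) -> Some (s, t, j) \notin c.
  by apply: contra => /lamp_cycleP[//|[i [-> -> _]]].
have Q2 s t t' j : Q (Some (s, t, j)) -> Q (Some (s, t', j)).
  have [l L2l <-] := perm_transitiveP t t' trL2.
  by move=> /(Qact l _ L2l) /=; rewrite perm1 bK.
have Q1 s s' t j : (s, t) != (D, d) -> Q (Some (s, t, j)) -> Q (nx (Some (s', t, j))).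
  move=> st; have [r L1r rs] := perm_transitiveP (b s) (b s') trL1.
  move=> /(Qact1 r _ L1r).
  by rewrite /lamp_act_conj lamp_cycle_prev_id ?off //= rs bK perm1.
(* The route inside layer [j] is [(D, d)], [(D, t0)], [(s, t0)], [(s, t)]: as [t0] differs from [d],
   the change of orbit avoids the cycle. *)
have QE s t j : Q (E j) -> (s, t) != (D, d) -> Q (Some (s, t, j)).
  move=> QEj st; have Dt0 : (D, t0) != (D, d) by rewrite xpair_eqE eqxx.
  have st0 : (s, t0) != (D, d) by rewrite xpair_eqE (negPf t0d) andbF.
  apply: (Q2 s t0); have := Q1 D s t0 j Dt0 (Q2 _ _ _ _ QEj).
  by rewrite lamp_cycle_next_id ?off.
(* From [E j] go to [(s0, d, j)], which is off the cycle; moving [s0] back to [D] by [P1] then lands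
   on the successor of [E j], because of the final [nx]. *)
have Qnext x : x \in c -> Q x -> Q (nx x).
  case/lamp_cycleP=> [-> _|[j ->] QEj]; first by rewrite lamp_cycle_nextNone.
  have s0d : (s0, d) != (D, d) by rewrite xpair_eqE (negPf s0D).
  exact: Q1 s0d (QE _ _ _ QEj s0d).
have Qc x : x \in c -> Q x.
  have E0c : E0 \in c by apply/lamp_cycleP; right; exists ord0.
  rewrite -(fconnect_cycle (cycle_next Uc) E0c) => /iter_findex <-.
  suff [] : iter (findex nx E0 x) nx E0 \in c /\ Q (iter (findex nx E0 x) nx E0) by [].
  elim: (findex _ _ _) => [//|i [ci Qi]].
  by rewrite iterS mem_next; split; last exact: Qnext.
case=> [[[s t] j]|]; last by apply: Qc; rewrite inE eqxx.
have QEj : Q (E j) by apply/Qc/lamp_cycleP; right; exists j.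
by have [[-> ->]//|st] := eqVneq (s, t) (D, d); apply: QE.
Qed.

Lemma core_free (K : {group {perm T1 * X}}) :
  K \subset P1 :&: P2 -> P1 \subset 'N(K) -> P2 \subset 'N(K) -> K :=: 1.
Proof.
move=> sKB nKP1 nKP2.
pose fix_fibre x := forall z y, z \in K -> z (y, x) = (y, x).
have KJ z p y x : z \in K -> p \in 'N(K) ->
    (forall z', z' \in K -> z' (y, x) = (y, x)) -> z (p (y, x)) = p (y, x).
  move=> Kz nKp fixK; have := fixK (z ^ p^-1).
  rewrite memJ_norm ?groupV // => /(_ Kz).
  by rewrite conjgE invgK !permM => /(canRL (permKV p)).
have fix_move x x' p (f : {perm T1}) : p \in 'N(K) ->
    (forall y, p (y, x) = (f y, x')) -> fix_fibre x -> fix_fibre x'.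
  move=> nKp pE fx z y Kz; rewrite -(permKV f y) -pE.
  by apply: KJ => // z' Kz'; apply: fx.
(* [K] fixes the base point over [E0] and is normal in [P1], which is transitive on that fibre. *)
have fixE0 : fix_fibre E0.
  move=> z y Kz; have [r L1r <-] := perm_transitiveP w y trL1.
  have [p [P1p <- _]] := left_ex L1r (group1 _) (rcoset_refl _ r).
  apply: KJ => // [|z' /(subsetP sKB)]; first exact: (subsetP nKP1).
  by rewrite inE => /andP[]; apply: borel_fix.
have fix_all : forall x, fix_fibre x.
  apply: lamp_connected => // [l x L2l|r x L1r].
    have [p P2p /(_ x)[f pE]] := right_ex (group1 _) L2l.
    exact: fix_move (subsetP nKP2 _ P2p) pE.
  have [p [P1p _ /(_ x)[f pE]]] := left_ex L1r (group1 _) (rcoset_refl _ r).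
  exact: fix_move (subsetP nKP1 _ P1p) pE.
apply/trivgP/subsetP=> z Kz; apply/set1P/permP=> -[y x].
by rewrite perm1 fix_all.
Qed.

Lemma lamp_amalgam : exists A : amalgam 2,
  [/\ amg_faithful A,
      forall i, perm_isomorphic (local_permGroup A i)
                  (permGroup_pair (PermGroup L1) (PermGroup L2) i)
    & (k < #|borel A|)%N].
Proof.
pose P (i : 'I_2) : {group {perm T1 * X}} := if i == ord0 then P1 else P2.
have capP : \bigcap_i P i = P1 :&: P2.
  by rewrite !big_ord_recl big_ord0 setIT.
exists (subgroup_amalgam P (ltnSn 1)); split; last first.
- by rewrite card_subgroup_amalgam_borel capP card_borel_gt.
- move=> i; rewrite /permGroup_pair; case: ifPn => [i0|i1].
    have Pi : P i = P1 by rewrite /P i0.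
    apply: (@subgroup_amalgam_local _ _ P _ i _ _
      (fun z (g : {perm T1}) => forall y, z (y, E0) = (g y, E0)) w) => //; rewrite ?capP ?Pi.
    + exact: left_fibre.
    + move=> l L1l; have [z [P1z zE _]] := left_ex L1l (group1 _) (rcoset_refl _ l).
      by exists z.
    + by move=> z z' l l' zE zE' y; rewrite !permM zE zE'.
    + by move=> z l l' zE zE'; apply/permP=> y; have := zE y; rewrite zE' => -[].
    + move=> z l P1z zE; rewrite inE P1z /=; apply/idP/eqP=> [P2z|lw].
        by have := borel_fix P1z P2z; rewrite zE => -[].
      by apply: left_stab; rewrite // zE lw.
  have Pi : P i = P2 by rewrite /P (negPf i1).
  apply: (@subgroup_amalgam_local _ _ P _ i _ _
    (fun z l => forall t y, (z (y, Some (D, t, ord0))).2 = Some (D, l t, ord0)) d)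
    => //; rewrite ?capP ?Pi.
  + exact: right_fibre.
  + move=> l L2l; have [z P2z zE] := right_ex (group1 _) L2l.
    exists z => // t y; have [f ->] := zE (Some (D, t, ord0)).
    by rewrite /= perm1 bK.
  + move=> z z' l l' zE zE' t y; rewrite !permM.
    by rewrite (surjective_pairing (z _)) zE zE'.
  + by move=> z l l' zE zE'; apply/permP=> t; have := zE t w; rewrite zE' => -[].
  + move=> z l P2z zE; rewrite inE P2z andbT; apply/idP/eqP=> [P1z|ld].
      by have := zE d w; rewrite (borel_fix P1z P2z) => -[].
    by apply: right_stab; rewrite // zE ld.
- apply: subgroup_amalgam_faithful => K; rewrite capP => sKB nKP.
  by apply: core_free => //; [apply: (nKP ord0) | apply: (nKP ord_max)].
Qed.

End Construction.

(** * From failure of semiprimitivity to the theorem *)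

Lemma not_semiprimitiveP (T : finType) (L : {group {perm T}}) :
    ~ perm_semiprimitive L ->
  exists N : {group {perm T}},
    [/\ N <| L, ~~ perm_transitive N
      & exists n y, [/\ n \in N, n y = y & n != 1]].
Proof.
(* By finiteness [bad] is a boolean test, so a witness is obtained constructively from the
   negation. *)
pose bad (N : {group {perm T}}) := [&& N <| L, ~~ perm_transitive N
  & [exists n in N, exists y, (n y == y) && (n != 1)]].
move=> nsp; have [/existsP[N /and3P[nNL ntrN]]|no_bad] := boolP [exists N, bad N].
  case/exists_inP=> n Nn /existsP[y /andP[/eqP ny n1]].
  by exists N; split=> //; exists n, y.
case: nsp => N nNL; have [trN|ntrN] := boolP (perm_transitive N); first by left.
right=> n Nn y ny; apply/eqP; apply: contraR no_bad => n1.
apply/existsP; exists N; rewrite /bad nNL ntrN; apply/exists_inP; exists n => //.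
by apply/existsP; exists y; rewrite ny eqxx.
Qed.

Lemma amalgam_of_not_semiprimitive (T1 T2 : finType)
    (L1 : {group {perm T1}}) (L2 : {group {perm T2}}) (k : nat) :
    L2 :!=: 1 -> perm_transitive L1 -> perm_transitive L2 ->
    ~ perm_semiprimitive L1 ->
  exists A : amalgam 2,
    [/\ amg_faithful A,
        forall i, perm_isomorphic (local_permGroup A i)
                    (permGroup_pair (PermGroup L1) (PermGroup L2) i)
      & (k < #|borel A|)%N].
Proof.
move=> L2nt trL1 trL2 nspL1.
have [N [nNL1 ntrN [n0 [y0 [Nn0 n0y0 n01]]]]] := not_semiprimitiveP nspL1.
pose Sigma := {O : {set T1} | O \in [set orbit 'P N y | y : T1]}.
have orbP y : orbit 'P N y \in [set orbit 'P N y | y : T1] by apply: imset_f.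
pose pi y : Sigma := Sub (orbit 'P N y) (orbP y).
have piP y y' : reflect (exists2 n : {perm T1}, n \in N & n y = y') (pi y == pi y').
  apply: (iffP eqP) => [/(congr1 val) /= e|[n Nn <-]].
    by have := orbit_refl 'P N y'; rewrite -e => /orbitP[n Nn <-]; exists n.
  by apply: val_inj; rewrite /= -[n y]/('P%act y n) orbit_act.
have [b bK] : exists b, cancel b pi.
  apply: (@fin_all_exists Sigma (fun=> T1) (fun s y => pi y = s)) => s.
  have /imsetP[y _ sE] := valP s.
  by exists y; apply: val_inj.
have [t0 [t1 t01]] : exists t0 t1 : T2, t1 != t0.
  have [l [L2l l1]] : exists l, l \in L2 /\ l != 1.
    by have /trivgPn[l L2l l1] := L2nt; exists l.
  have [t lt] : exists t, l t != t.
    apply/existsP; apply: contraR l1; rewrite negb_exists => /forallP l1.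
    by apply/eqP/permP=> t; rewrite perm1; apply/eqP/negPn/l1.
  by exists t, (l t).
apply: (@lamp_amalgam T1 T2 Sigma k L1 N L2 pi b (pi y0) t0) => //; last by exists t1.
  (* Conjugation by [r] in [L1] carries a nontrivial element of [N] fixing [y0] to one fixing
     [r y0]. *)
  move=> y; have [r L1r <-] := perm_transitiveP y0 y trL1.
  exists (n0 ^ r); rewrite memJ_norm ?(subsetP (normal_norm nNL1)) //.
  by rewrite permJ n0y0 conjg_eq1.
(* If the orbit of [y0] were the only one, [N] would be transitive. *)
apply/existsP; apply: contraR ntrN; rewrite negb_exists => /forallP Sigma1.
apply/imsetP; exists y0; rewrite ?inE //; apply/setP=> y; rewrite inE.
have /negPn/eqP/(congr1 val) /= <- := Sigma1 (pi y); exact/esym/orbit_refl.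
Qed.

Theorem theorem1p3 (T1 T2 : finType)
    (L1 : {group {perm T1}}) (L2 : {group {perm T2}})
    (L1_nontrivial : L1 :!=: 1) (L2_nontrivial : L2 :!=: 1)
    (L1_transitive : perm_transitive L1) (L2_transitive : perm_transitive L2)
    (not_semiprimitive : ~ perm_semiprimitive L1 \/ ~ perm_semiprimitive L2)
    (c : int) :
  exists A : amalgam 2,
    [/\ amg_faithful A,
        has_permutation_type A
          (permGroup_pair (PermGroup L1) (PermGroup L2))
      & (c <= #|borel A|%:Z)%R].
Proof.
have le_c n : (`|c| < n)%N -> (c <= n%:Z)%R.
  move=> cn; apply: Order.POrderTheory.le_trans (Num.Theory.ler_norm c) _.
  by rewrite -abszE lez_nat ltnW.
case: not_semiprimitive => [nsp|nsp].
  have [A [faithfulA isoA cA]] :=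
    amalgam_of_not_semiprimitive `|c| L2_nontrivial L1_transitive L2_transitive nsp.
  exists A; split=> //; last exact: le_c.
  by exists 1 => i; rewrite perm1.
have [A [faithfulA isoA cA]] :=
  amalgam_of_not_semiprimitive `|c| L1_nontrivial L2_transitive L1_transitive nsp.
exists A; split=> //; last exact: le_c.
(* The amalgam was built for the pair in reverse order; the type is a multiset, so a transposition
   restores it. *)
exists (tperm ord0 ord_max) => i; have := isoA i.
have [->|i1] := eqVneq i ord0; first by rewrite tpermL.
have -> : i = ord_max by apply: val_inj; case: i i1 => -[|[]].
by rewrite tpermR.
Qed.
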